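(* Consider the asymptotically optimal weights $\mathcal W_k^*=(\mathcal A+\mathcal R)^{-1}V\in\mathbb R^k$ for combining local ridge estimators under identity covariance (with $V,\mathcal A,\mathcal R$ as defined in the context), with optimally tuned regularization parameters $\lambda_i=\gamma_i/\alpha^2$, and denote its coordinates by $\mathcal W_{k,i}$. Then: 1. (Form of the optimal weights.) For $i=1,\dots,k$, $$\mathcal W_{k,i}=\left(\frac{\alpha^2}{\gamma_im_{\gamma_i}(-\gamma_i/\alpha^2)}\right)\cdot\left(\frac{1}{1+\sum_{j=1}^k\left[\frac{\alpha^2}{\gamma_jm_{\gamma_j}(-\gamma_j/\alpha^2)}-1\right]}\right),$$ and $\sum_{i=1}^k\mathcal W_{k,i}\ge1$. When $k\ge2$, $\sum_{i=1}^k\mathcal W_{k,i}>1$. 2. (Evenly distributed optimal weights.) When $\gamma_i=k\gamma$ for all $i$, all $\mathcal W_{k,i}$ equal the optimal weight function $$\mathcal W(k,\gamma,\alpha^2)=\frac{\alpha^2}{\alpha^2k+(1-k)k\gamma\cdot m_{k\gamma}(-k\gamma/\alpha^2)}=\frac{\alpha^2}{\alpha^2k-(k-1)\phi(k\gamma,\alpha^2)},$$ where $\phi(\gamma,\alpha^2)=\gamma m_\gamma(-\gamma/\alpha^2)$. 3. (Limiting cases.) For fixed $k$ and $\alpha^2$, $\mathcal W(k,\gamma,\alpha^2)$ is an increasing function of $\gamma\in[0,\infty)$ with $\lim_{\gamma\to0_+}\mathcal W(k,\gamma,\alpha^2)=1/k$ and $\lim_{\gamma\to\infty}\mathcal W(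k,\gamma,\alpha^2)=1$.
   Context: Parameters: an integer $k\ge1$ (number of machines), noise variance $\sigma^2>0$, signal-to-noise ratio $\alpha^2>0$, local limiting aspect ratios $\gamma_i=\lim p/n_i>0$, global aspect ratio $\gamma=\lim p/n>0$ (so $\sum_i1/\gamma_i=1/\gamma$), and regularization parameters $\lambda_i>0$. The Stieltjes transform is $$m_\gamma(z)=\frac{(z+\gamma-1)+\sqrt{(z+\gamma-1)^2-4z\gamma}}{-2z\gamma}$$ (principal branch), with derivative $m_\gamma'$ in $z$. Define $V\in\mathbb R^k$, $\mathcal A\in\mathbb R^{k\times k}$ and diagonal $\mathcal R\in\mathbb R^{k\times k}$ by $V_i=\sigma^2\alpha^2[1-\lambda_im_{\gamma_i}(-\lambda_i)]$; $\mathcal A_{ij}=\sigma^2\alpha^2[1-\lambda_im_{\gamma_i}(-\lambda_i)][1-\lambda_jm_{\gamma_j}(-\lambda_j)]$ for $i\ne j$; $\mathcal A_{ii}=\sigma^2\alpha^2[1-2\lambda_im_{\gamma_i}(-\lambda_i)+\lambda_i^2m'_{\gamma_i}(-\lambda_i)]$; $\mathcal R_{ii}=\sigma^2\gamma_i[m_{\gamma_i}(-\lambda_i)-\lambda_im'_{\gamma_i}(-\lambda_i)]$. Then $\mathcal W_k^*=(\mathcal A+\mathcal R)^{-1}V$ is the limit of the weights minimizing the mean squared error of $\sum_iw_i\hat\beta_i(\lambda_i)$, where $\hat\beta_i(\lambda_i)=(X_i^\top X_i+n_i\lambda_iI_p)^{-1}X_i^\top Y_i$, in the linear random-effects model with i.i.d.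 standardized design entries. ''Increasing'' in item 3 is in the weak sense when $k=1$ (where the function is constant), and the value at $\gamma=0$ is understood as the limit. *)

(* Defs.v *)
From HB Require Import structures.
From mathcomp Require Import all_boot all_order all_algebra.
From mathcomp Require Import all_classical all_reals all_analysis.

Set Implicit Arguments.
Unset Strict Implicit.
Unset Printing Implicit Defensive.

Import Order.TTheory GRing.Theory Num.Theory.
Import numFieldNormedType.Exports.

Local Open Scope classical_set_scope.
Local Open Scope ring_scope.

(* Restriction to the real axis of the Stieltjes transform of the
   Marchenko-Pastur law, evaluated below only at z < 0: there the discriminant
   is positive, and the principal branch of its square root is [Num.sqrt]. *)
Definition stieltjes (R : realType) (g z : R) : R :=
  ((z + g - 1) + Num.sqrt ((z + g - 1) ^+ 2 - 4 * z * g)) / (- 2 * z * g).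

Section OptimalWeights.
Variables (R : realType) (k : nat) (sigma2 alpha2 : R).
(* gam i : limit of p / n_i; lam i : regularization parameter of machine i *)
Variables gam lam : 'I_k -> R.

Let m (i : 'I_k) : R := stieltjes (gam i) (- lam i).
Let m' (i : 'I_k) : R := derive1 (stieltjes (gam i)) (- lam i).

Definition Vvec : 'cV[R]_k :=
  \col_i (sigma2 * alpha2 * (1 - lam i * m i)).

Definition Amx : 'M[R]_k :=
  \matrix_(i, j)
    if i == j then
      sigma2 * alpha2 * (1 - 2 * lam i * m i + lam i ^+ 2 * m' i)
    else
      sigma2 * alpha2 * (1 - lam i * m i) * (1 - lam j * m j).

Definition Rmx : 'M[R]_k :=
  diag_mx (\row_i (sigma2 * gam i * (m i - lam i * m' i))).

(* [invmx] is a genuine inverse only on [unitmx]. *)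
Definition opt_weights : 'cV[R]_k := invmx (Amx + Rmx) *m Vvec.

End OptimalWeights.

Definition phi (R : realType) (g alpha2 : R) : R :=
  g * stieltjes g (- (g / alpha2)).

Definition weight_fun (R : realType) (k : nat) (g alpha2 : R) : R :=
  alpha2 / (alpha2 * k%:R
    + (1 - k%:R) * (k%:R * g) * stieltjes (k%:R * g) (- ((k%:R * g) / alpha2))).

(* Extension of g |-> weight_fun k g alpha2 to [0, +oo[ by its right limit
   at 0. *)
Definition weight_fun0 (R : realType) (k : nat) (alpha2 g : R) : R :=
  if g == 0 then lim (weight_fun k x alpha2 @[x --> 0^'+])
  else weight_fun k g alpha2.

(* Main.v *)
(* With lam_i = gam_i / alpha2 the derivative terms of A + R cancel on the
   diagonal, so A + R = sigma2 alpha2 (diag(x_i (1 - x_i)) + x x^T) and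
   V = sigma2 alpha2 x with x_i = 1 - lam_i m_i: a rank-one perturbation of a
   positive diagonal matrix, whose system is solved by c_i = 1 / (1 - x_i) up to
   a common factor.
   For the analytic part, y = lam m is the root in ]0, 1[ of
   g (1 - y) (y + 1 / alpha2) = y; hence y increases with g, y = O(g) at 0 and
   1 - y <= 1 / g, and the evenly distributed weight is 1 / (k - (k - 1) y). *)
Require Import Defs.
From HB Require Import structures.
From mathcomp Require Import all_boot all_order all_algebra.
From mathcomp Require Import all_classical all_reals all_analysis.
From mathcomp Require Import ring lra.

Set Implicit Arguments.
Unset Strict Implicit.
Unset Printing Implicit Defensive.

Import Order.TTheory GRing.Theory Num.Theory.
Import numFieldNormedType.Exports.

Local Open Scope classical_set_scope.
Local Open Scope ring_scope.

(** * Systems with a diagonal plus rank-one matrix *)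

Section DiagPlusRankOne.
Variables (R : realFieldType) (n : nat) (d x : 'I_n -> R).
Hypothesis d_gt0 : forall i, 0 < d i.

Let M : 'M[R]_n := \matrix_(i, j) ((if i == j then d i else 0) + x i * x j).

Let mulM (w : 'cV[R]_n) i :
  (M *m w) i ord0 = d i * w i ord0 + x i * \sum_j x j * w j ord0.
Proof.
rewrite mxE mulr_sumr.
under eq_bigr => j _ do rewrite mxE mulrDl -mulrA.
rewrite big_split /=; congr (_ + _).
rewrite (bigD1 i) //= eqxx big1 ?addr0 // => j.
by rewrite eq_sym => /negPf ->; rewrite mul0r.
Qed.

(** Positive definiteness: for a kernel vector [u], pairing [M u] with [u] gives a sum of terms
    [d i * u i ^+ 2] plus the square of the scalar product of [x] and [u]; this vanishes only for
    [u = 0]. *)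
Lemma diag_plus_rank1_unitmx : M \in unitmx.
Proof.
have trM : M^T = M.
  apply/matrixP => i j; rewrite !mxE eq_sym mulrC.
  by case: eqP => [->|].
rewrite -row_free_unit -kermx_eq0; apply/eqP/row_matrixP => r; rewrite row0.
set u := row r _.
have uM : u *m M = 0 by rewrite -row_mul mulmx_ker row0.
have Mu : M *m u^T = 0 by rewrite -{1}trM -trmx_mul uM trmx0.
set t := \sum_j x j * u^T j ord0.
have eq0 i : d i * u^T i ord0 ^+ 2 + x i * u^T i ord0 * t = 0.
  transitivity ((M *m u^T) i ord0 * u^T i ord0); last by rewrite Mu mxE mul0r.
  by rewrite mulM -/t; ring.
have : \sum_i (d i * u^T i ord0 ^+ 2 + x i * u^T i ord0 * t) = 0.
  by rewrite big1.
have du_ge0 i : 0 <= d i * u^T i ord0 ^+ 2 by rewrite mulr_ge0 ?sqr_ge0 ?ltW.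
rewrite big_split /= -mulr_suml -/t -expr2 => /eqP.
rewrite paddr_eq0 ?sqr_ge0 ?sumr_ge0 // => /andP[]; rewrite psumr_eq0 //.
move=> /allP du0 _; apply/rowP => i; have := du0 i (mem_index_enum i).
by rewrite mulf_eq0 gt_eqF // expf_eq0 /= !mxE => /eqP.
Qed.

(** Since [d i * c i = x i], [M] maps [c] to [1 + \sum_j x j * c j] times [x]; dividing by this
    factor solves the system. *)
Lemma diag_plus_rank1_solve (c : 'I_n -> R) :
  (forall i, d i * c i = x i) -> 1 + \sum_j x j * c j != 0 ->
  M *m (\col_i (c i * (1 / (1 + \sum_j x j * c j)))) = \col_i x i.
Proof.
set S := \sum_j _ => dc S0; apply/colP => i; rewrite mulM !mxE mulrA dc.
under eq_bigr => j _ do rewrite mxE mulrA.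
by rewrite -mulr_suml -/S; field.
Qed.

End DiagPlusRankOne.

(** * The product [lam m] at the optimal tuning *)

Definition shrinkage (R : realType) (alpha2 g : R) : R :=
  g / alpha2 * stieltjes g (- (g / alpha2)).

Section Shrinkage.
Variables (R : realType) (alpha2 : R).
Hypothesis alpha2_gt0 : 0 < alpha2.
Local Notation y := (shrinkage alpha2).

(** With [l = g / alpha2], the value is [(g - 1 - l + s) / (2 * g)], where [s ^+ 2] equals both
    [(g - 1 - l) ^+ 2 + 4 * l * g] and [(g + 1 + l) ^+ 2 - 4 * g]. The first form gives positivity,
    the second the bound by 1. *)
Lemma shrinkage_spec (g : R) : 0 < g ->
  [/\ 0 < y g, y g < 1 & g * (1 - y g) * (y g + alpha2^-1) = y g].
Proof.
move=> g0; have a0 : 0 < alpha2^-1 by rewrite invr_gt0.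
rewrite /shrinkage /stieltjes; set a := alpha2^-1.
set l := g / alpha2; have l0 : 0 < l by exact: divr_gt0.
have lE : l = g * a by [].
set D := (_ ^+ 2 - _); set s := Num.sqrt D.
have DE : D = (g - 1 - l) ^+ 2 + 4 * l * g by rewrite /D; ring.
have s2 : s ^+ 2 = (g - 1 - l) ^+ 2 + 4 * l * g.
  by rewrite sqr_sqrtr DE //; have := mulr_gt0 l0 g0; have := sqr_ge0 (g - 1 - l); lra.
have s0 : 0 <= s by exact: sqrtr_ge0.
have lg := mulr_gt0 l0 g0.
have g20 : 2 * g != 0 by lra.
set z := l * (_ / _).
have zE : z = (g - 1 - l + s) / (2 * g).
  by rewrite /z; field; lra.
clearbody z.
have zg : 2 * g * z = g - 1 - l + s by rewrite zE; field; lra.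
have s_gt : 0 < g - 1 - l + s.
  rewrite ltNge; apply/negP => h.
  have : s ^+ 2 <= (g - 1 - l) ^+ 2 by nra.
  lra.
have s_lt : g - 1 - l + s < 2 * g.
  rewrite ltNge; apply/negP => h.
  have : (g + 1 + l) ^+ 2 <= s ^+ 2 by nra.
  rewrite s2; nra.
have z0 : 0 < z by rewrite zE divr_gt0 //; lra.
have z1 : z < 1 by rewrite zE ltr_pdivrMr; lra.
split=> //.
have sE : s = 2 * g * z - (g - 1 - l) by lra.
(* Eliminating [s] leaves the quadratic equation of [z], which is the claimed identity once
   [l = g * a]. *)
have : 4 * g * (g * z ^+ 2 - (g - 1 - l) * z - l) = 0.
  by move: s2; rewrite sE; lra.
move=> /eqP; rewrite mulf_eq0 => /orP[/eqP|/eqP]; first by lra.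
by rewrite lE; lra.
Qed.

Lemma shrinkage_lt : {in Num.pos &, {homo y : g h / g < h}}.
Proof.
move=> g h; rewrite !posrE => g0 h0 gh.
have [yg0 yg1 eg] := shrinkage_spec g0; have [yh0 yh1 eh] := shrinkage_spec h0.
have a0 : 0 < alpha2^-1 by rewrite invr_gt0.
rewrite ltNge; apply/negP => hg.
move: (y g) (y h) alpha2^-1 yg0 yg1 eg yh0 yh1 eh a0 hg.
move=> u v a u0 u1 eg v0 v1 eh a0 vu.
(* (1 - t) (t + a) / t decreases in t > 0, and equals 1 / g at t = u and 1 / h
   at t = v. *)
have uvE : (1 - v) * (v + a) * u =
    (1 - u) * (u + a) * v + (u - v) * (u * v + a) by ring.
have uv_ge0 : 0 <= (u - v) * (u * v + a).
  apply: mulr_ge0; first by rewrite subr_ge0.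
  by rewrite ltW // addr_gt0 // mulr_gt0.
have eu : g * ((1 - u) * (u + a) * v) = u * v by rewrite !mulrA eg.
have ev : h * ((1 - v) * (v + a) * u) = u * v by rewrite !mulrA eh mulrC.
have p : 0 < (1 - v) * (v + a) * u.
  by rewrite !mulr_gt0 ?subr_gt0 ?addr_gt0.
(* By [eu] and [ev] both sides equal [u * v], so this is absurd. *)
have : g * ((1 - u) * (u + a) * v) < h * ((1 - v) * (v + a) * u).
  apply: (@le_lt_trans _ _ (g * ((1 - v) * (v + a) * u))).
    by rewrite ler_pM2l // uvE lerDl.
  by rewrite ltr_pM2r.
by rewrite eu ev ltxx.
Qed.

Lemma shrinkage_cvg0 (k : R) : 0 < k -> y (k * g) @[g --> 0^'+] --> (0 : R).
Proof.
move=> k0; have a0 : 0 < alpha2^-1 by rewrite invr_gt0.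
apply: (@squeeze_cvgr _ _ _ _ (fun=> 0) (fun g => g * (k * (1 + alpha2^-1)))).
- near=> g.
  have g0 : 0 < g by near: g; exact: nbhs_right_gt.
  have kg0 : 0 < k * g by exact: mulr_gt0.
  have [y0 y1 e] := shrinkage_spec kg0.
  (* For [y] in ]0, 1[, [(1 - y) * (y + alpha2^-1)] is at most [1 + alpha2^-1]. *)
  by rewrite ltW //= mulrA [g * k]mulrC -[leLHS]e -mulrA ler_pM2l //; nra.
- exact: cvg_cst.
- rewrite -[X in _ --> X](mul0r (k * (1 + alpha2^-1))); apply: cvgM; last exact: cvg_cst.
  exact/cvg_at_right_filter/cvg_id.
Unshelve. all: by end_near. Qed.

Lemma shrinkage_cvg1 : y g @[g --> +oo] --> (1 : R).
Proof.
have a0 : 0 < alpha2^-1 by rewrite invr_gt0.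
apply: (@squeeze_cvgr _ _ _ _ (fun g => 1 - g^-1) (fun=> 1)).
- near=> g.
  have g0 : 0 < g by near: g; exact: nbhs_pinfty_gt.
  have [y0 y1 e] := shrinkage_spec g0.
  rewrite (ltW y1) andbT lerBlDr addrC -lerBlDr -(ler_pM2l g0) mulfV ?gt_eqF //.
  have p : 0 < g * (1 - y g) by apply: mulr_gt0; lra.
  (* Multiplied by [y g], the bound [g * (1 - y g) <= 1] reduces through [e] to
     [y g <= y g + alpha2^-1]. *)
  rewrite -(ler_pM2r y0) mul1r -[leRHS]e ler_pM2l //; lra.
- rewrite -[X in _ --> X](subr0 1); apply: cvgB; first exact: cvg_cst.
  by apply/gtr0_cvgV0; [near=> g; near: g; exact: nbhs_pinfty_gt | exact: cvg_id].
- exact: cvg_cst.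
Unshelve. all: by end_near. Qed.

(** * The evenly distributed weight: limits and monotonicity *)

Lemma stieltjesE (g : R) :
  g * stieltjes g (- (g / alpha2)) = alpha2 * y g.
Proof. by rewrite /shrinkage; field; rewrite gt_eqF. Qed.

Lemma weight_funE (k : nat) (g : R) :
  weight_fun k g alpha2 = (k%:R - (k%:R - 1) * y (k%:R * g))^-1.
Proof.
rewrite /weight_fun -mulrA stieltjesE.
have -> : alpha2 * k%:R + (1 - k%:R) * (alpha2 * y (k%:R * g)) =
  alpha2 * (k%:R - (k%:R - 1) * y (k%:R * g)) by ring.
by rewrite invfM mulrA mulfV ?gt_eqF // mul1r.
Qed.

Lemma weight_fun_cvg0 (k : nat) : (1 <= k)%N ->
  weight_fun k g alpha2 @[g --> 0^'+] --> (1 / k%:R : R).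
Proof.
move=> k1; have k0 : 0 < k%:R :> R by rewrite ltr0n.
under eq_fun do rewrite weight_funE.
rewrite div1r; apply: cvgV; first by rewrite gt_eqF.
have := cvgB (cvg_cst (k%:R : R)) (cvgM (cvg_cst (k%:R - 1 : R)) (shrinkage_cvg0 k0)).
by rewrite mulr0 subr0; apply.
Qed.

Lemma weight_fun_cvg1 (k : nat) : (1 <= k)%N ->
  weight_fun k g alpha2 @[g --> +oo] --> (1 : R).
Proof.
move=> k1; have k0 : 0 < k%:R :> R by rewrite ltr0n.
under eq_fun do rewrite weight_funE.
have yk1 : y (k%:R * g) @[g --> +oo] --> (1 : R).
  by apply: (cvg_comp _ _ _ shrinkage_cvg1); exact/gt0_cvgMry/cvg_id.
have den1 : k%:R - (k%:R - 1) * y (k%:R * g) @[g --> +oo] --> (1 : R).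
  have := cvgB (cvg_cst (k%:R : R)) (cvgM (cvg_cst (k%:R - 1 : R)) yk1).
  by rewrite mulr1 subKr; apply.
by have := cvgV (oner_neq0 R) den1; rewrite invr1; apply.
Qed.

(** The limit [1 / k] amounts to extending [y] by 0 at 0, so one formula serves the whole closed
    half-line. *)
Lemma weight_fun0E (k : nat) (g : R) : (1 <= k)%N ->
  weight_fun0 k alpha2 g =
  (k%:R - (k%:R - 1) * (if g == 0 then 0 else y (k%:R * g)))^-1.
Proof.
move=> k1; rewrite /weight_fun0; case: eqP => _; last exact: weight_funE.
rewrite mulr0 subr0 -div1r.
exact/cvg_lim/weight_fun_cvg0.
Qed.

Lemma weight_fun0_lt (k : nat) : (2 <= k)%N ->
  {in `[0, +oo[ &, {homo weight_fun0 k alpha2 : x y / x < y}}.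
Proof.
move=> k2 g h; rewrite !in_itv /= !andbT => g0 h0 gh.
have k1 : (1 <= k)%N by exact: ltnW.
have kp : 0 < k%:R :> R by rewrite ltr0n.
have kR : 1 < k%:R :> R by rewrite ltr1n.
have hp : 0 < h by exact: le_lt_trans gh.
have khp : 0 < k%:R * h by exact: mulr_gt0.
rewrite !weight_fun0E // (gt_eqF hp).
have [yh0 yh1 _] := shrinkage_spec khp.
set u := if _ then _ else _.
have uv : u < y (k%:R * h).
  rewrite /u; case: eqP => [//|/eqP gN0].
  have gp : 0 < g by rewrite lt_neqAle eq_sym gN0.
  by apply: shrinkage_lt; rewrite ?posrE ?mulr_gt0 ?ltr_pM2l.
have p : 0 < k%:R - (k%:R - 1) * y (k%:R * h) by nra.
by rewrite ltf_pV2 ?posrE //; nra.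
Qed.

Lemma weight_fun0_le (k : nat) : (1 <= k)%N ->
  {in `[0, +oo[ &, {homo weight_fun0 k alpha2 : x y / x <= y}}.
Proof.
rewrite leq_eqVlt => /predU1P[<- g h _ _ _|k2 g h g0 h0].
  by rewrite !weight_fun0E // !subrr !mul0r.
rewrite le_eqVlt => /predU1P[-> //|gh].
exact/ltW/weight_fun0_lt.
Qed.

End Shrinkage.

(** * The weights at the optimal tuning *)

Lemma opt_tuned_mxE (R : realType) (k : nat) (sigma2 alpha2 : R)
    (gam : 'I_k -> R) (x := fun i => 1 - shrinkage alpha2 (gam i)) :
  alpha2 != 0 ->
  Amx sigma2 alpha2 gam (fun i => gam i / alpha2) +
    Rmx sigma2 gam (fun i => gam i / alpha2) =
  (sigma2 * alpha2) *: \matrix_(i, j)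
    ((if i == j then x i * (1 - x i) else 0) + x i * x j).
Proof.
move=> a0; apply/matrixP => i j; rewrite !mxE /x /shrinkage.
case: eqP => [<-|_] /=.
  (* As [gam i = alpha2 * lam i], the diagonal entry collapses to [sigma2 * alpha2 * x i], and
     [x i = x i * (1 - x i) + x i * x i]. *)
  by rewrite mulr1n; field.
by rewrite mulr0n addr0 add0r; ring.
Qed.

Theorem theorem4p5 (R : realType) (k : nat) (sigma2 alpha2 : R)
    (hk : (1 <= k)%N) (hsigma2 : 0 < sigma2) (halpha2 : 0 < alpha2) :
  (forall (gam : 'I_k -> R) (g : R),
    (forall i, 0 < gam i) -> 0 < g -> \sum_(i < k) (gam i)^-1 = g^-1 ->
    let lam := fun i : 'I_k => gam i / alpha2 in
    let c := fun i : 'I_k =>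
      alpha2 / (gam i * stieltjes (gam i) (- (gam i / alpha2))) in
    let W := opt_weights sigma2 alpha2 gam lam in
    [/\ Amx sigma2 alpha2 gam lam + Rmx sigma2 gam lam \in unitmx,
        forall i : 'I_k,
          W i ord0 = c i * (1 / (1 + \sum_(j < k) (c j - 1))),
        1 <= \sum_(i < k) W i ord0,
        (2 <= k)%N -> 1 < \sum_(i < k) W i ord0 &
        (forall i : 'I_k, gam i = k%:R * g) ->
          (forall i : 'I_k, W i ord0 = weight_fun k g alpha2) /\
          weight_fun k g alpha2 =
            alpha2 / (alpha2 * k%:R - (k%:R - 1) * phi (k%:R * g) alpha2)])
  /\
  [/\ {in `[0, +oo[ &,
         {homo weight_fun0 k alpha2 : x y / x <= y}},
      (2 <= k)%N -> {in `[0, +oo[ &,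
         {homo weight_fun0 k alpha2 : x y / x < y}},
      weight_fun k x alpha2 @[x --> 0^'+] --> (1 / k%:R : R) &
      weight_fun k x alpha2 @[x --> +oo] --> (1 : R)].

Proof.
have sa0 : sigma2 * alpha2 != 0 by rewrite mulf_neq0 ?gt_eqF.
split; last first.
  by split; [exact: weight_fun0_le|exact: weight_fun0_lt|
             exact: weight_fun_cvg0|exact: weight_fun_cvg1].
move=> gam g gam0 g0 sumg lam c W.
pose y i := shrinkage alpha2 (gam i); pose x i := 1 - y i.
have y0 i : 0 < y i by have [] := shrinkage_spec halpha2 (gam0 i).
have y1 i : y i < 1 by have [] := shrinkage_spec halpha2 (gam0 i).
have cE i : c i = (y i)^-1.
  by rewrite /c stieltjesE // invfM mulrA mulfV ?gt_eqF // mul1r.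
(* This turns the scalar product of [x] and [c] into the sum in the stated denominator. *)
have xc i : x i * c i = c i - 1.
  by rewrite cE /x mulrBl mul1r mulfV // gt_eqF.
have c1 i : 0 < c i - 1 by rewrite cE subr_gt0 invf_gt1.
have d0 i : 0 < x i * (1 - x i) by rewrite mulr_gt0 // /x; have := y0 i; have := y1 i; lra.
have dc i : x i * (1 - x i) * c i = x i.
  by rewrite cE /x; field; rewrite gt_eqF.
set S := \sum_(j < k) (c j - 1).
have S0 : 0 <= S by apply: sumr_ge0 => j _; exact: ltW.
have SE : \sum_j x j * c j = S by exact: eq_bigr.
have S1 : 1 + S != 0 by lra.
have Munit : Amx sigma2 alpha2 gam lam + Rmx sigma2 gam lam \in unitmx.
  rewrite opt_tuned_mxE ?gt_eqF // unitmxZ ?unitfE //.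
  exact: diag_plus_rank1_unitmx.
have WE i : W i ord0 = c i * (1 / (1 + S)).
  suff -> : W = \col_i (c i * (1 / (1 + S))) by rewrite mxE.
  (* It suffices that the matrix sends the candidate to [Vvec]. *)
  rewrite -[RHS](mulKmx Munit) /W /opt_weights; congr (_ *m _).
  rewrite opt_tuned_mxE ?gt_eqF // -scalemxAl -SE diag_plus_rank1_solve ?SE //.
  by apply/colP => j; rewrite !mxE.
(* The [c i] add up to [S + k], so comparing the total weight with 1 is comparing [k] with 1. *)
have sumc : \sum_(i < k) W i ord0 = (S + k%:R) / (1 + S).
  under eq_bigr => i _ do rewrite WE.
  rewrite -mulr_suml div1r; congr (_ / _).
  by rewrite /S big_split /= sumrN sumr_const card_ord subrK.
have S1p : 0 < 1 + S by lra.
split=> //.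
- by rewrite sumc ler_pdivlMr // mul1r addrC lerD2l ler1n.
- by move=> k2; rewrite sumc ltr_pdivlMr // mul1r addrC ltrD2l ltr1n.
move=> gamE; split; last first.
  by rewrite /weight_fun /phi; congr (_ / _); ring.
move=> i; rewrite WE weight_funE // -(gamE i) -/(y i).
have cc j : c j = (y i)^-1 by rewrite cE /y !gamE.
have SE' : S = k%:R * ((y i)^-1 - 1).
  by rewrite /S (eq_bigr _ (fun j _ => congr1 (fun t => t - 1) (cc j))) sumr_const card_ord mulr_natl.
have yi := y0 i; have yi1 := y1 i.
have kR : 1 <= k%:R :> R by rewrite ler1n.
have q0 : k%:R - (k%:R - 1) * y i != 0 by nra.
(* With all [c j = (y i)^-1], multiplying [1 + S] by [y i] yields [k - (k - 1) * y i]. *)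
move: S1; rewrite SE' cc => S1; field.
by rewrite ?q0 ?S1 ?gt_eqF.
Qed.
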